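(* Let $X$ be a uniformly perfect metric space with more than one point, let $\Phi$ be any admissible function, and let $$\theta_1:=\liminf_{\delta\to0^+}\frac{\log\delta}{\log\Phi(\delta)},\qquad\theta_2:=\limsup_{\delta\to0^+}\frac{\log\delta}{\log\Phi(\delta)},$$ so that $0\le\theta_1\le\theta_2\le1$. Let $F\subseteq X$ be non-empty and totally bounded with $\dim_{\mathrm A}F<\infty$. Then: (1) If $0=\theta_2=\lim_{\delta\to0^+}\frac{\log\delta}{\log\Phi(\delta)}$ then $\underline{\dim}^\Phi F\le\underline{\dim}_\theta F$ and $\overline{\dim}^\Phi F\le\overline{\dim}_\theta F$ for all $\theta\in(0,1]$. (2) If $0=\theta_1<\theta_2$ then $\underline{\dim}_{\theta_2}F\le\overline{\dim}^\Phi F\le\overline{\dim}_{\theta_2}F$ (so if $\underline{\dim}_{\theta_2}F=\overline{\dim}_{\theta_2}F$ then $\overline{\dim}^\Phi F$ equals this common value), and $\underline{\dim}^\Phi F\le\min\{\overline{\dim}_\theta F,\underline{\dim}_{\theta_2}F\}$ for all $\theta\in(0,1]$. (3) If $0<\theta_1\le\theta_2$ then $$\underline{\dim}_{\theta_1}F\le\underline{\dim}^\Phi F\le\min\{\overline{\dim}_{\theta_1}F,\underline{\dim}_{\theta_2}F\},$$ $$\max\{\overline{\dim}_{\theta_1}F,\underline{\dim}_{\theta_2}F\}\le\overline{\dim}^\Phi F\le\overline{\dim}_{\theta_2}F.$$ (4) If $0<\theta_1=\theta_2$ then $\underline{\dim}^\Phi F=\underline{\dim}_{\theta_1}F$ and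 $\overline{\dim}^\Phi F=\overline{\dim}_{\theta_1}F$.
   Context: For a subset $U$ of a metric space, $|U|$ denotes its diameter, and $B(x,r)$ is the open ball. Convention: $\inf\varnothing=\infty$. A metric space $X$ is uniformly perfect if there is $c\in(0,1)$ such that $B(x,R)\setminus B(x,cR)\neq\varnothing$ for all $x\in X$ and $0<R<|X|$. $N_\delta(F)$ is the smallest number of open balls of radius $\delta/2$ with centres in $F$ needed to cover $F$; $F$ is totally bounded if $N_\delta(F)<\infty$ for all $\delta>0$. A function $\Phi\colon(0,\Delta)\to\mathbb{R}$ (for some $\Delta>0$) is admissible if it is monotonic, $0<\Phi(\delta)\le\delta$ for all $\delta\in(0,\Delta)$, and $\Phi(\delta)/\delta\to0$ as $\delta\to0^+$. For a non-empty totally bounded $F\subseteq X$ and admissible $\Phi$, the upper $\Phi$-intermediate dimension $\overline{\dim}^\Phi F$ is the infimum of all $s\ge0$ such that for all $\epsilon>0$ there exists $\delta_0\in(0,1]$ (with $(0,\delta_0)$ contained in the domain of $\Phi$) such that for all $\delta\in(0,\delta_0)$ there is a finite or countable cover $\{U_1,U_2,\dots\}$ of $F$ by subsets of $X$ with $\Phi(\delta)\le|U_i|\le\delta$ for all $i$ and $\sum_i|U_i|^s\le\epsilon$. The lower $\Phi$-intermediate dimension $\underline{\dim}^\Phi F$ is the infimum of all $s\ge0$ such that for all $\epsilon>0$ and $\delta_0\in(0,1]$ there exist $\delta\in(0,\delta_0)$ (in the domain of $\Phi$) and such a cover of $F$ with $\Phi(\delta)\le|U_i|\le\delta$ for all $i$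 and $\sum_i|U_i|^s\le\epsilon$. Intermediate dimensions: for $\theta\in(0,1)$, $\overline{\dim}_\theta F:=\overline{\dim}^{\Phi}F$ and $\underline{\dim}_\theta F:=\underline{\dim}^{\Phi}F$ with the choice $\Phi(\delta)=\delta^{1/\theta}$. For $\theta=1$, $\overline{\dim}_1F$ and $\underline{\dim}_1F$ are the upper and lower box dimensions, i.e. the $\limsup$ and $\liminf$ as $\delta\to0^+$ of $\log N_\delta(F)/(-\log\delta)$. The Assouad dimension $\dim_{\mathrm A}F$ is the infimum of all $a$ for which there exists $C>0$ such that $N_r(B(x,R)\cap F)\le C(R/r)^a$ for all $x\in F$ and $0<r<R$. *)

(* Defs.v *)
From HB Require Import structures.
From mathcomp Require Import all_boot all_order all_algebra.
From mathcomp Require Import all_classical all_reals all_analysis.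

Set Implicit Arguments.
Unset Strict Implicit.
Unset Printing Implicit Defensive.

Import Order.TTheory GRing.Theory Num.Theory.
Import numFieldTopology.Exports.

Local Open Scope classical_set_scope.
Local Open Scope ring_scope.

Section metric_notions.
Context {R : realType} {X : metricType R}.
Implicit Types (U F : set X) (Phi : R -> R).

(* Adding 0 only matters for the empty set, whose diameter is 0. *)
Definition diam U : \bar R :=
  maxe 0%E (ereal_sup [set (mdist p.1 p.2)%:E | p in U `*` U]).

(* Smallest number of open balls of radius delta / 2 centred in F covering F;
   it is +oo when no finite family of such balls covers F. *)
Definition covering_number (delta : R) F : \bar R :=
  ereal_inf [set (n%:R)%:E | n in [set n : nat | exists c : 'I_n -> X,
    (forall i, F (c i)) /\ F `<=` \bigcup_i ball (c i) (delta / 2)]].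

Definition totally_bounded F : Prop :=
  forall delta : R, 0 < delta -> (covering_number delta F < +oo)%E.

Definition assouad_dim F : \bar R :=
  ereal_inf [set a%:E | a in [set a : R | exists2 C : R, 0 < C &
    forall (x : X) (r R0 : R), F x -> 0 < r -> r < R0 ->
      (covering_number r (ball x R0 `&` F) <= (C * (R0 / r) `^ a)%:E)%E]].

Definition upper_box_dim F : \bar R :=
  limf_esup (fun delta : R =>
    lne (covering_number delta F) / (- ln delta)%:E)%E 0^'+.

Definition lower_box_dim F : \bar R :=
  limf_einf (fun delta : R =>
    lne (covering_number delta F) / (- ln delta)%:E)%E 0^'+.

(* A finite or countable cover (U_i), indexed by a set I of natural numbers. *)
Definition has_cover (lo hi s eps : R) F : Prop :=
  exists (I : set nat) (U : nat -> set X),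
    [/\ F `<=` \bigcup_(i in I) U i,
        forall i, I i -> (lo%:E <= diam (U i) <= hi%:E)%E &
        (\esum_(i in I) (diam (U i) `^ s) <= eps%:E)%E].

(* A function (0, Delta) -> R is encoded as a total function Phi : R -> R
   together with Delta; its values outside (0, Delta) are never used. *)
Definition upper_Phi_dim (Delta : R) Phi F : \bar R :=
  ereal_inf [set s%:E | s in [set s : R | 0 <= s /\
    forall eps : R, 0 < eps ->
      exists delta0 : R, [/\ 0 < delta0 <= 1, delta0 <= Delta &
        forall delta : R, 0 < delta < delta0 ->
          has_cover (Phi delta) delta s eps F]]].

Definition lower_Phi_dim (Delta : R) Phi F : \bar R :=
  ereal_inf [set s%:E | s in [set s : R | 0 <= s /\
    forall eps delta0 : R, 0 < eps -> 0 < delta0 <= 1 ->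
      exists delta : R, [/\ 0 < delta < delta0, delta < Delta &
        has_cover (Phi delta) delta s eps F]]].

(* Meaningful for 0 < theta <= 1. For theta < 1, delta `^ theta^-1 is taken on
   (0, 1), where it is at most delta. *)
Definition upper_intermediate_dim (theta : R) F : \bar R :=
  if theta == 1 then upper_box_dim F
  else upper_Phi_dim 1 (fun delta => delta `^ theta^-1) F.

Definition lower_intermediate_dim (theta : R) F : \bar R :=
  if theta == 1 then lower_box_dim F
  else lower_Phi_dim 1 (fun delta => delta `^ theta^-1) F.

End metric_notions.

Definition uniformly_perfect {R : realType} (X : metricType R) : Prop :=
  exists2 c : R, 0 < c < 1 &
    forall (x : X) (r : R), 0 < r -> (r%:E < diam [set: X])%E ->
      ball x r `\` ball x (c * r) !=set0.

Definition admissible {R : realType} (Delta : R) (Phi : R -> R) : Prop :=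
  [/\ 0 < Delta,
      {in `]0, Delta[ &, {homo Phi : x y / x <= y}} \/
      {in `]0, Delta[ &, {homo Phi : x y /~ x <= y}},
      forall delta, 0 < delta < Delta -> 0 < Phi delta <= delta &
      Phi delta / delta @[delta --> 0^'+] --> 0].

Definition log_ratio {R : realType} (Phi : R -> R) (delta : R) : R :=
  ln delta / ln (Phi delta).

(* Main.v *)
(* All the dimensions are critical exponents of one kind of covering statement
   "at scale delta there is a cover of s-cost at most eps", required for all small
   delta (upper) or for arbitrarily small delta (lower); for theta = 1 the covers
   are by N balls of radius delta / 2 and the cost is N * delta^s. When
   log delta / log (Phi delta) is close to theta, a cover with diameters in
   [delta^(1/theta), delta] becomes one with diameters in [Phi delta, delta], and
   conversely: uniform perfectness allows one to add a point to each set that is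
   too small, so that its diameter is comparable to the new lower bound, and this
   costs only an arbitrarily small increase of the exponent s. Only one side of
   the closeness matters for each direction, so a liminf or limsup bound on the log
   ratio, valid eventually or just frequently, gives each inequality. *)

Require Import Defs.
From HB Require Import structures.
From mathcomp Require Import all_boot all_order all_algebra.
From mathcomp Require Import finmap.
From mathcomp Require Import all_classical all_reals all_analysis.
From mathcomp Require Import ring lra.

Set Implicit Arguments.
Unset Strict Implicit.
Unset Printing Implicit Defensive.

Import Order.TTheory GRing.Theory Num.Theory.
Import numFieldTopology.Exports.

Local Open Scope classical_set_scope.
Local Open Scope ring_scope.

(** * Limits superior and inferior along a filter *)

Definition frequently {T : Type} (G : set_system T) (P : set T) : Prop :=
  forall V, G V -> exists2 x, V x & P x.

Section limits_along_filters.
Context {R : realType} {T : topologicalType}.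
Context (G : set_system T) {FG : ProperFilter G}.
Implicit Types (f : T -> \bar R) (P Q : set T) (a : \bar R).

Lemma frequentlyI P Q : frequently G P -> G Q -> frequently G (P `&` Q).
Proof.
move=> GP GQ V GV; have [x [Vx Qx] Px] := GP _ (filterI GV GQ).
by exists x.
Qed.

Lemma frequently_sub P Q : P `<=` Q -> frequently G P -> frequently G Q.
Proof. by move=> PQ GP V /GP[x Vx /PQ]; exists x. Qed.

Lemma limf_esup_lt f a : (limf_esup f G < a)%E -> \forall x \near G, (f x < a)%E.
Proof.
rewrite limf_esupE => /ereal_inf_lt[_ [V GV <-]] fa.
apply: filterS GV => x Vx; apply: le_lt_trans fa.
by apply: ereal_sup_ubound; exists x.
Qed.

Lemma limf_esup_gt f a :
  (a < limf_esup f G)%E -> frequently G (fun x => (a < f x)%E).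
Proof.
rewrite limf_esupE => af V GV.
have : (a < ereal_sup (f @` V))%E.
  by apply: lt_le_trans af _; apply: ereal_inf_lbound; exists V.
by move=> /ereal_sup_gt[_ [x Vx <-]]; exists x.
Qed.

Lemma limf_esup_le f a :
  (\forall x \near G, (f x <= a)%E) -> (limf_esup f G <= a)%E.
Proof.
move=> fa; rewrite limf_esupE; apply: ge_ereal_inf.
exists (ereal_sup (f @` [set x | (f x <= a)%E])); last first.
  by apply: ge_ereal_sup => _ [x ? <-].
by exists [set x | (f x <= a)%E].
Qed.

Lemma limf_einf_gt f a : (a < limf_einf f G)%E -> \forall x \near G, (a < f x)%E.
Proof.
rewrite limf_einfE => /ereal_sup_gt[_ [V GV <-]] fa.
apply: filterS GV => x Vx; apply: lt_le_trans fa _.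
by apply: ereal_inf_lbound; exists x.
Qed.

Lemma limf_einf_lt f a :
  (limf_einf f G < a)%E -> frequently G (fun x => (f x < a)%E).
Proof.
rewrite limf_einfE => af V GV.
have : (ereal_inf (f @` V) < a)%E.
  by apply: le_lt_trans af; apply: ereal_sup_ubound; exists V.
by move=> /ereal_inf_lt[_ [x Vx <-]]; exists x.
Qed.

Lemma limf_einf_le f a :
  frequently G (fun x => (f x <= a)%E) -> (limf_einf f G <= a)%E.
Proof.
move=> fa; rewrite limf_einfE; apply: ge_ereal_sup => _ [V /fa[x Vx xa] <-].
by apply: ge_ereal_inf; exists (f x) => //; exists x.
Qed.

Lemma limf_einf_ge f a :
  (\forall x \near G, (a <= f x)%E) -> (a <= limf_einf f G)%E.
Proof.
move=> fa; rewrite limf_einfE; apply: le_ereal_sup_tmp.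
exists (ereal_inf (f @` [set x | (a <= f x)%E])); last first.
  by apply: le_ereal_inf_tmp => _ [x ? <-].
by exists [set x | (a <= f x)%E].
Qed.

(** Two members of a proper filter meet, and the value of [f] at a common point lies between the
    infimum over one and the supremum over the other. *)
Lemma limf_einf_le_esup f : (limf_einf f G <= limf_esup f G)%E.
Proof.
rewrite limf_einfE limf_esupE; apply: ge_ereal_sup => _ [V GV <-].
apply: le_ereal_inf_tmp => _ [W GW <-].
have [x [Vx Wx]] := filter_ex (filterI GV GW).
apply: (@le_trans _ _ (f x)); first by apply: ereal_inf_lbound; exists x.
by apply: ereal_sup_ubound; exists x.
Qed.

End limits_along_filters.

(** * Critical exponents and how they compare *)

Section critical_exponents.
Context {R : realType}.
Implicit Types (Q : set_system R) (A B : R -> R -> R -> Prop) (P : set R).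

(* [A s eps delta] reads "there is a cover at scale delta of s-cost at most eps".
   Upper dimensions take for [Q] the filter of right neighbourhoods of 0, lower
   ones the sets that meet all of them. *)
Definition critical_exponent Q A : \bar R :=
  ereal_inf [set s%:E | s in [set s : R | 0 <= s /\
    forall eps, 0 < eps -> Q (A s eps)]].

(** The loss [eta] disappears because it is arbitrary, and the factor [M] because [eps] runs through
    all positive numbers: start from [eps / M]. *)
Lemma critical_exponent_le Q Q' A B :
  (forall s eta, 0 <= s -> 0 < eta -> exists2 M, 0 < M &
    forall eps, 0 < eps -> Q (A s eps) -> Q' (B (s + eta) (M * eps))) ->
  (critical_exponent Q' B <= critical_exponent Q A)%E.
Proof.
move=> AB; apply: le_ereal_inf_tmp => _ [s [s0 As] <-].
apply/lee_addgt0Pr => eta eta0; rewrite -EFinD.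
have [M M0 MAB] := AB s eta s0 eta0.
apply: ereal_inf_lbound; exists (s + eta) => //; split=> [|eps eps0].
  by rewrite addr_ge0// ltW.
rewrite -(mulVKf (negbT (gt_eqF M0)) eps); apply: MAB; last apply: As.
all: by rewrite mulr_gt0// invr_gt0.
Qed.

Lemma near0_scale P (lam : R) : 0 < lam ->
  (\forall d \near (0 : R)^'+, P (lam * d)) -> \forall d \near (0 : R)^'+, P d.
Proof.
move=> lam0 [e /= e0 eP]; exists (lam * e) => /=; first exact: mulr_gt0.
move=> d /= de d0; rewrite -(mulVKf (negbT (gt_eqF lam0)) d); apply: eP => /=.
  move: de; rewrite !sub0r !normrN !gtr0_norm// ?mulr_gt0 ?invr_gt0//.
  by rewrite ltr_pdivrMl.
by rewrite mulr_gt0 ?invr_gt0.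
Qed.

Lemma frequently0_scale P (lam : R) : 0 < lam ->
  frequently (0 : R)^'+ (fun d => P (lam * d)) -> frequently (0 : R)^'+ P.
Proof.
move=> lam0 PG V GV; have ilam0 : 0 < lam^-1 by rewrite invr_gt0.
have : \forall d \near (0 : R)^'+, V (lam * d).
  apply: (near0_scale ilam0); apply: filterS GV => d.
  by rewrite mulVKf// gt_eqF.
by move=> /PG[d]; exists (lam * d).
Qed.

(** [C s eta d] is the requirement on the scale, later an inequality for the log ratio. Keeping it
    apart lets one transfer serve both when it holds eventually and when it holds only frequently.
    [lam] and [M] depend on neither [d] nor [eps]. *)
Definition transfers (C : R -> R -> R -> Prop) A B : Prop :=
  forall s eta, 0 <= s -> 0 < eta -> exists lam M, [/\ 0 < lam, 0 < M &
    \forall d \near (0 : R)^'+, C s eta d ->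
      forall eps, A s eps d -> B (s + eta) (M * eps) (lam * d)].

Lemma upper_le_upper C A B : transfers C A B ->
  (forall s eta, 0 <= s -> 0 < eta -> \forall d \near (0 : R)^'+, C s eta d) ->
  (critical_exponent (0 : R)^'+ B <= critical_exponent (0 : R)^'+ A)%E.
Proof.
move=> AB nC; apply: critical_exponent_le => s eta s0 eta0.
have [lam [M [lam0 M0 MAB]]] := AB s eta s0 eta0; exists M => // eps eps0 Aeps.
apply: (near0_scale lam0); have := nC s eta s0 eta0.
by apply: filterS3 Aeps MAB => d Ad ABd Cd; exact: ABd.
Qed.

Lemma lower_le_lower C A B : transfers C A B ->
  (forall s eta, 0 <= s -> 0 < eta -> \forall d \near (0 : R)^'+, C s eta d) ->
  (critical_exponent (frequently (0 : R)^'+) B <=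
   critical_exponent (frequently (0 : R)^'+) A)%E.
Proof.
move=> AB nC; apply: critical_exponent_le => s eta s0 eta0.
have [lam [M [lam0 M0 MAB]]] := AB s eta s0 eta0; exists M => // eps eps0 Aeps.
apply: (frequently0_scale lam0).
apply: frequently_sub (frequentlyI Aeps (filterI (nC s eta s0 eta0) MAB)).
by move=> d [Ad [Cd ABd]]; exact: ABd.
Qed.

(** A frequent property still meets an eventual one. As [A] holds at all small scales, the condition
    [C] may be merely frequent, and [B] is then reached at arbitrarily small scales. *)
Lemma lower_le_upper C A B : transfers C A B ->
  (forall s eta, 0 <= s -> 0 < eta -> frequently (0 : R)^'+ (C s eta)) ->
  (critical_exponent (frequently (0 : R)^'+) B <=
   critical_exponent (0 : R)^'+ A)%E.
Proof.
move=> AB nC; apply: critical_exponent_le => s eta s0 eta0.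
have [lam [M [lam0 M0 MAB]]] := AB s eta s0 eta0; exists M => // eps eps0 Aeps.
apply: (frequently0_scale lam0).
apply: frequently_sub (frequentlyI (nC s eta s0 eta0) (filterI Aeps MAB)).
by move=> d [Cd [Ad ABd]]; exact: ABd.
Qed.

End critical_exponents.

(** * Right neighbourhoods of 0 in terms of intervals *)

Section right_neighbourhoods.
Context {R : realType}.
Implicit Types P : set R.

Lemma near0_rightP P :
  (\forall d \near (0 : R)^'+, P d) <->
  exists2 e, 0 < e & forall d, 0 < d < e -> P d.
Proof.
split=> [[e /= e0 eP]|[e e0 eP]].
  exists e => // d /andP[d0 de]; apply: eP => //=.
  by rewrite sub0r normrN gtr0_norm.
near=> d; apply: eP; apply/andP; split; near: d; first exact: nbhs_right_gt.
exact: nbhs_right_lt.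
Unshelve. all: by end_near. Qed.

Lemma frequently0_rightP P :
  frequently (0 : R)^'+ P <->
  forall e, 0 < e -> exists2 d, 0 < d < e & P d.
Proof.
split=> [PG e e0|PG V /near0_rightP[e e0 eV]]; last first.
  by have [d de Pd] := PG e e0; exists d => //; exact: eV.
by apply: PG; apply/near0_rightP; exists e.
Qed.

Lemma near0_le (e : R) : 0 < e -> \forall d \near (0 : R)^'+, 0 < d < e.
Proof. by move=> e0; apply/near0_rightP; exists e. Qed.

End right_neighbourhoods.

(** * The dimensions as critical exponents *)

Section dimensions_as_critical_exponents.
Context {R : realType} {X : metricType R}.
Implicit Types (F : set X) (Phi : R -> R).

Definition phi_cover Phi F (s eps d : R) : Prop := has_cover (Phi d) d s eps F.

Lemma upper_Phi_dimE (Delta : R) Phi F : 0 < Delta ->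
  upper_Phi_dim Delta Phi F = critical_exponent (0 : R)^'+ (phi_cover Phi F).
Proof.
move=> Delta0; congr ereal_inf; congr (image _ _).
apply/seteqP; split=> s /= [s0 sF]; split=> // eps /sF.
  move=> [e [/andP[e0 _] _ eF]]; apply/near0_rightP; exists e => //.
(* The minimum keeps [delta0] in (0, 1] and within the domain of [Phi]. *)
move=> /near0_rightP[e e0 eF]; exists (Num.min e (Num.min 1 Delta)).
by rewrite !lt_min !ge_min e0 ltr01 Delta0 !lexx ?orbT; split=> // d;
  rewrite !lt_min => /and4P[d0 de _ _]; apply: eF; rewrite d0.
Qed.

Lemma lower_Phi_dimE (Delta : R) Phi F : 0 < Delta ->
  lower_Phi_dim Delta Phi F =
  critical_exponent (frequently (0 : R)^'+) (phi_cover Phi F).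
Proof.
move=> Delta0; congr ereal_inf; congr (image _ _).
apply/seteqP; split=> s /= [s0 sF]; split=> // eps.
  move=> eps0; apply/frequently0_rightP => e e0.
  have [||d [/andP[d0]]] := sF eps (Num.min e 1) => //.
    by rewrite lt_min e0 ltr01 ge_min lexx orbT.
  by rewrite lt_min => /andP[de _] _ ?; exists d => //; rewrite d0.
move=> e /sF /frequently0_rightP PG /andP[e0 _].
have [|d] := PG (Num.min e Delta); first by rewrite lt_min e0.
by rewrite lt_min => /and3P[d0 de dDelta] dF; exists d; rewrite d0.
Qed.

Definition box_cover F (s eps d : R) : Prop :=
  exists (n : nat) (c : 'I_n -> X), [/\ forall i, F (c i),
    F `<=` \bigcup_i ball (c i) (d / 2) & n%:R * d `^ s <= eps].

Lemma covering_number_ge1 (d : R) F : F !=set0 -> (1 <= covering_number d F)%E.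
Proof.
move=> [x Fx]; apply: le_ereal_inf_tmp => _ [n [c [_ Fc]] <-].
rewrite lee_fin; have [i _ _] := Fc x Fx.
by case: n i {c Fc} => [[]//|n _]; rewrite ler1n.
Qed.

Let box_quotient F d := (lne (covering_number d F) / (- ln d)%:E)%E.

Lemma box_quotient_ge0 F (d : R) :
  F !=set0 -> 0 < d < 1 -> (0 <= box_quotient F d)%E.
Proof.
move=> F0 d01; have lnd : ln d < 0 by exact: ln_lt0.
rewrite mule_ge0 ?lne_ge0 ?covering_number_ge1// inve_ge0 lee_fin.
by rewrite oppr_ge0 ltW.
Qed.

(** For eps = 1 the cost bound reads n <= d^(-s). Take logarithms and divide by - ln d > 0. *)
Lemma box_quotient_le F (d s : R) : F !=set0 -> 0 < d < 1 ->
  box_cover F s 1 d -> (box_quotient F d <= s%:E)%E.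
Proof.
move=> F0 d01 [n [c [Fc cF nd]]]; have /andP[d0 d1] := d01.
have lnd : ln d < 0 by exact: ln_lt0.
have Nn : (covering_number d F <= n%:R%:E)%E.
  by apply: ereal_inf_lbound; exists n => //; exists c.
have n1 : 1 <= n%:R :> R.
  by rewrite -lee_fin (le_trans (covering_number_ge1 d F0)).
have n0 : 0 < n%:R :> R by rewrite (lt_le_trans ltr01).
rewrite /box_quotient inver oppr_eq0 lt_eqF// lee_pdivrMr ?oppr_gt0//.
apply: (@le_trans _ _ (lne (n%:R : R)%:E)).
  rewrite lee_lne// in_itv/= leey andbT ?lee_fin ?ltW//.
  by rewrite (lt_le_trans _ (covering_number_ge1 d F0)) ?lte_fin.
rewrite lne_EFin// -EFinM lee_fin mulrN -ln_powR -lnV ?posrE ?powR_gt0//.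
by rewrite ler_ln ?posrE ?invr_gt0 ?powR_gt0// -[leRHS]mul1r ler_pdivlMr ?powR_gt0.
Qed.

(** A quotient below t means N < d^(-t), so the cost N d^s is at most d^(s - t). The gap between t
    and s is what makes the cost small. *)
Lemma box_quotient_lt F (d s t eps : R) : F !=set0 -> 0 < d < 1 ->
  d `^ (s - t) <= eps -> (box_quotient F d < t%:E)%E -> box_cover F s eps d.
Proof.
move=> F0 d01 deps; have /andP[d0 d1] := d01.
have lnd : ln d < 0 by exact: ln_lt0.
rewrite /box_quotient inver oppr_eq0 lt_eqF// lte_pdivrMr ?oppr_gt0//.
rewrite -EFinM mulrN -ln_powR -lnV ?posrE ?powR_gt0//.
rewrite -lne_EFin ?invr_gt0 ?powR_gt0//.
rewrite lte_lne ?in_itv/= ?leey ?andbT; last 2 first.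
- by rewrite (le_trans _ (covering_number_ge1 d F0))// lee_fin.
- by rewrite lee_fin invr_ge0 powR_ge0.
move=> /ereal_inf_lt[_ [n [c [Fc cF]] <-]]; rewrite lte_fin => nd.
exists n, c; split=> //; apply: le_trans deps.
rewrite powRD; last by rewrite (gt_eqF d0) implybT.
by rewrite powRN mulrC ler_pM2l ?powR_gt0// ltW.
Qed.

(** Supplies two exponents above [y]: [t] bounds the box quotient, and [s - t > 0] lets d^(s - t)
    tend to 0. Since [y] is nonnegative, [s] is too. *)
Let le_of_dense (x y : \bar R) : (0 <= y)%E ->
  (forall s t, 0 <= s -> t < s -> (y < t%:E)%E -> (x <= s%:E)%E) -> (x <= y)%E.
Proof.
case: y => [r| |]; [|by rewrite !leey|by []].
rewrite lee_fin => r0 xr; apply/lee_addgt0Pr => e e0; rewrite -EFinD.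
by apply: (xr _ (r + e / 2)); rewrite ?lte_fin; lra.
Qed.

Let near_in01 := near0_le (ltr01 : 0 < 1 :> R).

Let near_powR_le (t eps : R) : 0 < t -> 0 < eps ->
  \forall d \near (0 : R)^'+, d `^ t <= eps.
Proof.
move=> t0 eps0; have /cvgrPdist_le /(_ _ eps0) := powR_cvg0 t0.
by apply: filterS => d; rewrite sub0r normrN ger0_norm ?powR_ge0.
Qed.

Lemma upper_box_dimE F : F !=set0 ->
  upper_box_dim F = critical_exponent (0 : R)^'+ (box_cover F).
Proof.
move=> F0; apply/eqP; rewrite eq_le; apply/andP; split.
  apply: le_ereal_inf_tmp => _ [s [s0 sF] <-]; apply: limf_esup_le.
  by apply: filterS2 near_in01 (sF 1 ltr01) => d d01; exact: box_quotient_le.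
apply: le_of_dense => [|s t s0 ts /limf_esup_lt Ft].
  apply: le_trans (limf_einf_le_esup _); apply: limf_einf_ge.
  by apply: filterS near_in01 => d; exact: box_quotient_ge0.
apply: ereal_inf_lbound; exists s => //; split=> // eps eps0.
have st : 0 < s - t by rewrite subr_gt0.
apply: filterS3 near_in01 (near_powR_le st eps0) Ft => d.
exact: box_quotient_lt.
Qed.

Lemma lower_box_dimE F : F !=set0 ->
  lower_box_dim F = critical_exponent (frequently (0 : R)^'+) (box_cover F).
Proof.
move=> F0; apply/eqP; rewrite eq_le; apply/andP; split.
  apply: le_ereal_inf_tmp => _ [s [s0 sF] <-]; apply: limf_einf_le.
  apply: frequently_sub (frequentlyI (sF 1 ltr01) near_in01) => d [? ?].
  exact: box_quotient_le.
apply: le_of_dense => [|s t s0 ts /limf_einf_lt Ft].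
  by apply: limf_einf_ge; apply: filterS near_in01 => d; exact: box_quotient_ge0.
apply: ereal_inf_lbound; exists s => //; split=> // eps eps0.
have st : 0 < s - t by rewrite subr_gt0.
apply: frequently_sub (frequentlyI Ft (filterI near_in01 (near_powR_le st eps0))).
by move=> d [? [? ?]]; exact: (@box_quotient_lt _ _ _ t).
Qed.

Definition theta_cover (theta : R) F : R -> R -> R -> Prop :=
  if theta == 1 then box_cover F else phi_cover (fun d => d `^ theta^-1) F.

Lemma upper_intermediate_dimE (theta : R) F : F !=set0 ->
  upper_intermediate_dim theta F =
  critical_exponent (0 : R)^'+ (theta_cover theta F).
Proof.
move=> F0; rewrite /upper_intermediate_dim /theta_cover; case: ifP => _.
  exact: upper_box_dimE.
exact: upper_Phi_dimE.
Qed.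

Lemma lower_intermediate_dimE (theta : R) F : F !=set0 ->
  lower_intermediate_dim theta F =
  critical_exponent (frequently (0 : R)^'+) (theta_cover theta F).
Proof.
move=> F0; rewrite /lower_intermediate_dim /theta_cover; case: ifP => _.
  exact: lower_box_dimE.
exact: lower_Phi_dimE.
Qed.

End dimensions_as_critical_exponents.

(** * Diameters and the modification of covers *)

Section covers.
Context {R : realType} {X : metricType R}.
Implicit Types (U F : set X).

Lemma mdist_le_diam U (x y : X) : U x -> U y -> ((mdist x y)%:E <= diam U)%E.
Proof.
move=> Ux Uy; rewrite /diam le_max; apply/orP; right.
by apply: ereal_sup_ubound; exists (x, y).
Qed.

Lemma diam_le U (r : R) : 0 <= r ->
  (forall x y, U x -> U y -> mdist x y <= r) -> (diam U <= r%:E)%E.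
Proof.
move=> r0 Ur; rewrite /diam ge_max lee_fin r0.
by apply: ge_ereal_sup => _ [[x y] [/= Ux Uy] <-]; rewrite lee_fin Ur.
Qed.

Lemma diam_gt0_nonempty U : (0 < diam U)%E -> U !=set0.
Proof.
rewrite /diam lt_max ltxx => /ereal_sup_gt[_ [[x y] [/= Ux _] _] _].
by exists x.
Qed.

Definition perfect_with (c : R) : Prop := forall (x : X) (r : R), 0 < r ->
  (r%:E < diam [set: X])%E -> ball x r `\` ball x (c * r) !=set0.

(** Uniform perfectness at radius L / c, where the inner radius is L. *)
Lemma perfect_with_annulus (c L : R) (x : X) : 0 < c -> 0 < L ->
  perfect_with c -> ((L / c)%:E < diam [set: X])%E ->
  exists y : X, L <= mdist x y < L / c.
Proof.
move=> c0 L0 Xc LX; have [|y] := Xc x (L / c) _ LX; first exact: divr_gt0.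
rewrite !ballEmdist/= => -[yL /negP]; rewrite -leNgt mulrC divfK ?gt_eqF// => Ly.
by exists y; rewrite Ly.
Qed.

Lemma le_esum_scale (I : set nat) (a b : nat -> \bar R) (M eps : R) : 0 <= M ->
  (forall i, 0 <= a i)%E -> (forall i, I i -> b i <= M%:E * a i)%E ->
  (\esum_(i in I) a i <= eps%:E)%E -> (\esum_(i in I) b i <= (M * eps)%:E)%E.
Proof.
move=> M0 a0 ba aeps; apply: ge_ereal_sup => _ [J [finJ JI] <-].
apply: (@le_trans _ _ (\sum_(i \in J) (M%:E * a i))%E).
  by apply: lee_fsum => // i /JI /ba.
rewrite -ge0_mule_fsumr// EFinM lee_wpmul2l ?lee_fin//.
by apply: le_trans aeps; apply: ereal_sup_ubound; exists J.
Qed.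

Lemma fsum_cst (J : set nat) (r : R) : finite_set J ->
  (\sum_(i \in J) r%:E = (#|` fset_set J|%:R * r)%:E)%E.
Proof.
move=> finJ; rewrite fsbig_finite// sumEFin big_const_seq count_predT.
by rewrite iter_addr_0 mulr_natl.
Qed.

(* Sets of diameter below [L] are enlarged to diameter comparable to [L] by
   adding one point, which uniform perfectness provides. *)
Lemma has_cover_enlarge (c lo L hi s s' eps : R) F :
  0 < c < 1 -> perfect_with c -> (hi%:E < diam [set: X])%E ->
  0 <= s <= s' -> 0 < lo -> 0 < L -> 2 * L / c <= hi -> hi <= 1 ->
  L `^ s' <= lo `^ s ->
  has_cover lo hi s eps F -> has_cover L hi s' ((2 / c) `^ s' * eps) F.
Proof.
move=> /andP[c0 c1] Xc hiX /andP[s0 ss'] lo0 L0 Lhi hi1 Llo [I [U [FU Ub Ueps]]].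
have s'0 : 0 <= s' := le_trans s0 ss'.
have LLc : L <= L / c by rewrite ler_pdivlMr// ler_piMr// ltW.
have Lc : L / c <= hi.
  by apply: le_trans Lhi; rewrite -mulrA ler_peMl ?divr_ge0 ?ltW// ltrDl.
have c21 : 1 <= 2 / c by rewrite ler_pdivlMr//; lra.
have M1 : 1 <= (2 / c) `^ s' by have := ler_powR c21 s'0; rewrite powRr0.
have M0 : 0 <= (2 / c) `^ s' by exact: powR_ge0.
(* Each [U i] is replaced separately. The empty set is a dummy value for indices outside [I]. *)
have : forall i, exists V : set X, I i -> [/\ U i `<=` V,
    (L%:E <= diam V <= hi%:E)%E &
    (diam V `^ s' <= ((2 / c) `^ s')%:E * diam (U i) `^ s)%E].
  move=> i; have [Ii|] := pselect (I i); last by exists set0.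
  have := Ub i Ii; case Er : (diam (U i)) => [r| |]; last 2 first.
  - by rewrite leye_eq andbF.
  - by rewrite leeNy_eq.
  rewrite !lee_fin => /andP[lor rhi]; have r0 : 0 < r := lt_le_trans lo0 lor.
  have lors : lo `^ s <= r `^ s by rewrite ge0_ler_powR// nnegrE ltW.
  (* A set of diameter r >= L is kept: r <= hi <= 1 and s <= s' give r^s' <= r^s. *)
  have [Lr|rL] := leP L r.
    exists (U i) => _; split=> //; rewrite Er ?lee_fin ?Lr//.
    rewrite (@le_trans _ _ (r `^ s))//.
      by rewrite ger_powR// r0 (le_trans rhi).
    by rewrite ler_peMl// powR_ge0.
  (* Otherwise add a point y at distance in [L, L / c) from a point x of the set. The new diameter
     is at least L and at most r + L / c <= 2 L / c <= hi. *)
  have [x Ux] : U i !=set0 by apply: diam_gt0_nonempty; rewrite Er lte_fin.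
  have LX : ((L / c)%:E < diam [set: X])%E by rewrite (le_lt_trans _ hiX).
  have [y /andP[Ly yL]] := perfect_with_annulus x c0 L0 Xc LX.
  exists (U i `|` [set y]) => _.
  have dV : (diam (U i `|` [set y]) <= (2 * L / c)%:E)%E.
    have Ur z w : U i z -> U i w -> mdist z w <= r.
      by move=> Uz Uw; rewrite -lee_fin -Er mdist_le_diam.
    have Uy z : U i z -> mdist z y <= 2 * L / c.
      move=> Uz; rewrite (le_trans (metric_triangle _ x _))//.
      have := Ur _ _ Uz Ux; lra.
    have r2 : r <= 2 * L / c by rewrite -mulrA; lra.
    apply: diam_le => [|z w [Uz|->] [Uw|->]]; rewrite ?mdistxx; last 4 first.
    - by rewrite (le_trans (Ur _ _ Uz Uw)).
    - exact: Uy.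
    - by rewrite metric_sym; exact: Uy.
    - by rewrite (le_trans _ r2)// ltW.
    by rewrite (le_trans _ r2)// ltW.
  have VL : (L%:E <= diam (U i `|` [set y]))%E.
    rewrite (@le_trans _ _ (mdist x y)%:E) ?lee_fin//.
    by apply: mdist_le_diam; [left|right].
  split=> //; first by rewrite VL (le_trans dV) ?lee_fin.
  move: VL dV; case: (diam _) => [v| |]; last 2 first.
  - by rewrite leye_eq.
  - by rewrite leeNy_eq.
  rewrite !poweR_EFin -EFinM !lee_fin => Lv vL.
  (* The chain is v^s' <= (2 L / c)^s' = (2 / c)^s' L^s' <= (2 / c)^s' lo^s <= (2 / c)^s' r^s. *)
  apply: (@le_trans _ _ ((2 / c * L) `^ s')).
    rewrite ge0_ler_powR ?nnegrE//; lra.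
  rewrite powRM ?(le_trans ler01 c21) ?(ltW L0)// ler_wpM2l//.
  exact: le_trans lors.
move=> /choice[V UV]; exists I, V; split=> [x /FU[i Ii Uix]|i /UV[]//|].
  by exists i => //; have [+ _ _] := UV i Ii; exact.
apply: le_esum_scale Ueps => // [i|i /UV[]//]; exact: poweR_ge0.
Qed.

(* Balls of radius [3 * d / 2] around points of [F] contain the sets of diameter
   at most [d] that meet [F], whence the change of scale. *)
Lemma has_cover_box (lo d s s' eps : R) F : 0 < d -> 0 < lo -> 0 <= s ->
  d `^ s' <= lo `^ s ->
  has_cover lo d s eps F -> box_cover F s' (3 `^ s' * eps) (3 * d).
Proof.
move=> d0 lo0 s0 dlo [I [U [FU Ub Ueps]]].
have los0 : 0 < lo `^ s by exact: powR_gt0.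
(* Every set of the cover contributes at least lo^s to a sum bounded by [eps]. *)
have card_le (J : set nat) : finite_set J -> J `<=` I ->
    #|` fset_set J|%:R * lo `^ s <= eps.
  move=> finJ JI; rewrite -lee_fin -fsum_cst// (le_trans _ Ueps)//.
  apply: esum_ge; exists J => //; apply: lee_fsum => // i /JI /Ub /andP[loU _].
  rewrite -poweR_EFin gt0_ler_poweR ?in_itv/= ?leey ?andbT//.
    by rewrite lee_fin ltW.
  by rewrite (le_trans _ loU)// lee_fin ltW.
(* Only sets meeting [F] are kept, so that the centres can be chosen in [F]. *)
pose J := [set i | I i /\ U i `&` F !=set0].
have JI : J `<=` I by move=> i [].
(* An infinite [J] would have a finite subset with more than eps / lo^s elements, against
   [card_le]. *)
have finJ : finite_set J.
  apply: contrapT => /(infinite_set_fset (Num.truncn (eps / lo `^ s)).+1)[B BJ].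
  have := card_le _ (finite_fset B) (subset_trans BJ JI).
  rewrite set_fsetK -ler_pdivlMr// => Beps nB.
  have : eps / lo `^ s < #|` B|%:R.
    by rewrite (lt_le_trans (truncnS_gt _))// ler_nat.
  by rewrite ltNge Beps.
pose A := fset_set J.
have AP (j : 'I_#|` A|) : J (nth 0%N A j).
  have : nth 0%N A j \in A by exact: mem_nth.
  by rewrite in_fset_set// inE.
have /choice[c cP] : forall j : 'I_#|` A|, exists x, U (nth 0%N A j) x /\ F x.
  by move=> j; have [_ [x]] := AP j; exists x.
exists #|` A|, c; split=> [j|x Fx|]; first by have [] := cP j.
  have [i Ii Uix] := FU x Fx.
  have iA : i \in A by rewrite in_fset_set// inE; split=> //; exists x.
  have iA' : (index i A < #|` A|)%N by rewrite index_mem.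
  (* The point and the centre share a set of diameter at most d, and d < 3 d / 2, the radius of the
     balls at scale 3 d. *)
  exists (Ordinal iA') => //; have [/= ] := cP (Ordinal iA').
  rewrite nth_index// => Uic _; rewrite ballEmdist/=.
  have /andP[_] := Ub i Ii; move=> /(le_trans (mdist_le_diam Uic Uix)).
  by rewrite lee_fin; lra.
rewrite powRM ?(ltW d0)// mulrCA ler_wpM2l ?powR_ge0//.
by apply: le_trans (card_le _ finJ JI); rewrite ler_wpM2l.
Qed.

(** A ball of radius d / 2 has diameter at most d, and uniform perfectness puts in it a point at
    distance at least c d / 2 from the centre. *)
Lemma box_has_cover (c d s eps : R) F :
  0 < c -> perfect_with c -> 0 < d -> (d%:E < diam [set: X])%E -> 0 <= s ->
  box_cover F s eps d -> has_cover (c * d / 2) d s eps F.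
Proof.
move=> c0 Xc d0 dX s0 [n [x [_ Fx neps]]].
(* The existential extends the family of balls to all natural numbers, by the empty set from [n]
   on. *)
pose U i := [set y | exists2 j : 'I_n, val j = i & ball (x j) (d / 2) y].
have UE (j : 'I_n) : U j = ball (x j) (d / 2).
  by apply/seteqP; split=> [y [k /val_inj ->]//|y ?]; exists j.
have Ub i : `I_n i -> ((c * d / 2)%:E <= diam (U i) <= d%:E)%E.
  move=> ni; rewrite -[i]/(val (Ordinal ni)) UE; apply/andP; split.
    have [||y [yd nyd]] := Xc (x (Ordinal ni)) (d / 2); first exact: divr_gt0.
      by rewrite (le_lt_trans _ dX)// lee_fin; lra.
    move: nyd; rewrite mulrA ballEmdist/= => /negP; rewrite -leNgt => cy.
    rewrite (@le_trans _ _ (mdist (x (Ordinal ni)) y)%:E) ?lee_fin//.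
    by apply: mdist_le_diam => //; apply: ballxx; exact: divr_gt0.
  apply: diam_le => [|y z]; first exact: ltW.
  rewrite !ballEmdist/= => yd zd.
  rewrite (le_trans (metric_triangle _ (x (Ordinal ni)) _))// metric_sym; lra.
exists `I_n, U; split=> // [y /Fx[j _ yj]|].
  by exists j; [exact: ltn_ord|rewrite UE].
apply: (@le_trans _ _ (\esum_(i in `I_n) (d `^ s)%:E)%E).
  apply: le_esum => i /Ub /andP[cU Ud].
  have U0 : (0 <= diam (U i))%E.
    by rewrite (le_trans _ cU)// lee_fin divr_ge0 ?mulr_ge0 ?ltW.
  by rewrite -poweR_EFin gt0_ler_poweR ?in_itv/= ?leey ?andbT// lee_fin ltW.
rewrite esum_fset//; last by move=> *; rewrite lee_fin powR_ge0.
by rewrite fsum_cst// (@card_fset_set _ _ n)// lee_fin.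
Qed.

End covers.

(** * Transfer between Phi-covers and theta-covers *)

Section comparison.
Context {R : realType} {X : metricType R}.
Implicit Types (F : set X) (s eta theta : R).

Lemma ler_powR_ln (a b s t : R) : 0 < a -> 0 < b ->
  s * ln a <= t * ln b -> a `^ s <= b `^ t.
Proof. by move=> a0 b0 ab; rewrite /powR !gt_eqF// ler_expR. Qed.

(** Here [l] stands for the log ratio: a bound on it slightly above [theta] is paid for by raising
    [s] to [s + eta]. The denominator [s + 1] stays positive at s = 0. *)
Lemma exponent_above theta s eta : 0 < theta -> 0 <= s -> 0 < eta ->
  exists2 t, theta < t & forall l, l < t -> l * s <= theta * (s + eta).
Proof.
move=> theta0 s0 eta0; have s1 : 0 < s + 1 by lra.
exists (theta + theta * eta / (s + 1)) => [|l lt].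
  by rewrite ltrDl divr_gt0// mulr_gt0.
apply: (@le_trans _ _ ((theta + theta * eta / (s + 1)) * s)).
  by rewrite ler_wpM2r// ltW.
rewrite mulrDl mulrDr lerD2l mulrAC ler_pdivrMr// ler_wpM2l ?mulr_ge0 ?ltW//.
by rewrite ltrDl.
Qed.

(** The counterpart for lower bounds on the log ratio, with threshold theta s / (s + eta). *)
Lemma exponent_below theta s eta : 0 < theta -> 0 <= s -> 0 < eta ->
  exists2 t, t < theta & forall l, t < l -> theta * s <= l * (s + eta).
Proof.
move=> theta0 s0 eta0; have se0 : 0 < s + eta by lra.
exists (theta * s / (s + eta)) => [|l tl].
  by rewrite ltr_pdivrMr// ltr_pM2l// ltrDl.
by rewrite -ler_pdivrMr// ltW.
Qed.

Lemma near0_diam (x y : X) : x <> y ->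
  \forall d \near (0 : R)^'+, (d%:E < diam [set: X])%E.
Proof.
move=> xy; have xy0 : 0 < mdist x y by rewrite mdist_gt0; apply/eqP.
apply: filterS (near0_le xy0) => d /andP[_ dxy].
by rewrite (@lt_le_trans _ _ (mdist x y)%:E) ?lte_fin// mdist_le_diam.
Qed.

Context (Delta : R) (Phi : R -> R) (Phi_adm : admissible Delta Phi).

(** The bound by [k * d] comes from Phi(d) / d tending to 0. It leaves the room between [Phi d] and
    [d] that enlarging sets requires. *)
Lemma near0_admissible (k : R) : 0 < k -> \forall d \near (0 : R)^'+,
  [/\ 0 < d < 1, 0 < Phi d <= k * d, ln (Phi d) < 0, 0 <= log_ratio Phi d <= 1 &
      ln d = log_ratio Phi d * ln (Phi d)].
Proof.
move=> k0; have [Delta0 _ Phi_le /cvgrPdist_le /(_ _ k0) Phik] := Phi_adm.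
apply: filterS3 (near0_le ltr01) (near0_le Delta0) Phik => d d01 dD.
have /andP[P0 Pd] := Phi_le d dD; have /andP[d0 d1] := d01.
have lnd : ln d < 0 by exact: ln_lt0.
have lnP : ln (Phi d) <= ln d by rewrite ler_ln.
have lnP0 : ln (Phi d) < 0 := le_lt_trans lnP lnd.
have Pd0 : 0 <= Phi d / d by rewrite divr_ge0 ?ltW.
rewrite sub0r normrN (ger0_norm Pd0) ler_pdivrMr// => Pk.
split; rewrite ?P0// /log_ratio; last by rewrite divfK// lt_eqF.
by rewrite ler_ndivlMr// ler_ndivrMr// mul0r mul1r lnP (ltW lnd).
Qed.

Context (c : R) (c01 : 0 < c < 1) (Xc : @perfect_with _ X c).
Context (X_nontrivial : exists x y : X, x <> y).

(** Sets are enlarged to diameter at least Phi(d), which requires Phi(d)^(s + eta) <= d^(s / theta).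
    Writing ln d as the log ratio times ln Phi(d) and dividing by ln Phi(d) < 0 turns this into the
    stated condition. *)
Lemma theta_to_Phi theta F : 0 < theta <= 1 ->
  transfers (fun s eta d => log_ratio Phi d * s <= theta * (s + eta))
    (theta_cover theta F) (phi_cover Phi F).
Proof.
move=> /andP[theta0 theta1] s eta s0 eta0; have /andP[c0 c1] := c01.
have [x [y xy]] := X_nontrivial.
exists 1, ((2 / c) `^ (s + eta)); split=> //; first by rewrite powR_gt0 ?divr_gt0.
(* With k = c / 2 one gets both 2 Phi(d) / c <= d, to enlarge sets, and Phi(d) <= c d / 2, to
   compare with the balls of a box cover. *)
have c20 : 0 < c / 2 by rewrite divr_gt0.
apply: filterS2 (near0_admissible c20) (near0_diam xy) => d.
move=> [/andP[d0 d1] /andP[P0 Pd] lnP lr01 lndE] dX lrs eps.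
have sse : 0 <= s <= s + eta by rewrite s0 lerDl ltW.
have Pcd : 2 * Phi d / c <= d by rewrite ler_pdivrMr//; lra.
rewrite mul1r /phi_cover /theta_cover; case: ifPn => [_ /box_has_cover|_ /=].
  move=> /(_ _ c0 Xc d0 dX s0).
  apply: has_cover_enlarge => //; rewrite ?(ltW d1) ?divr_gt0 ?mulr_gt0//.
  have Pcd' : Phi d <= c * d / 2 by lra.
  apply: (@le_trans _ _ (Phi d `^ s)).
    by rewrite ger_powR ?P0 ?lerDl ?(ltW eta0)//=; nra.
  by rewrite ge0_ler_powR// nnegrE ltW// divr_gt0 ?mulr_gt0.
apply: has_cover_enlarge => //; rewrite ?powR_gt0 ?(ltW d1)//.
apply: ler_powR_ln; rewrite ?powR_gt0// ln_powR lndE.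
have -> : s * (theta^-1 * (log_ratio Phi d * ln (Phi d))) =
  log_ratio Phi d * s / theta * ln (Phi d) by ring.
by rewrite ler_wnM2r ?(ltW lnP)// ler_pdivrMr// [leRHS]mulrC.
Qed.

(** The reverse passage: the lower bound on diameters becomes d^(1 / theta), and the same
    computation gives the reversed requirement on the log ratio. *)
Lemma Phi_to_theta theta F : 0 < theta <= 1 ->
  transfers (fun s eta d => theta * s <= log_ratio Phi d * (s + eta))
    (phi_cover Phi F) (theta_cover theta F).
Proof.
move=> /andP[theta0 theta1] s eta s0 eta0; have /andP[c0 c1] := c01.
have [x [y xy]] := X_nontrivial.
have sse : 0 <= s <= s + eta by rewrite s0 lerDl ltW.
have key d : 0 < d -> 0 < Phi d -> ln (Phi d) < 0 ->
    ln d = log_ratio Phi d * ln (Phi d) ->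
    theta * s <= log_ratio Phi d * (s + eta) ->
    (d `^ theta^-1) `^ (s + eta) <= Phi d `^ s.
  move=> d0 P0 lnP lndE lrs; apply: ler_powR_ln; rewrite ?powR_gt0// ln_powR lndE.
  have -> : (s + eta) * (theta^-1 * (log_ratio Phi d * ln (Phi d))) =
    log_ratio Phi d * (s + eta) / theta * ln (Phi d) by ring.
  by rewrite ler_wnM2r ?(ltW lnP)// ler_pdivlMr// [leLHS]mulrC.
rewrite /theta_cover; case: ifPn => [/eqP th1|th1].
  (* For theta = 1 the sets become balls, at three times the scale. *)
  exists 3, (3 `^ (s + eta)); split=> //.
  apply: filterS (near0_admissible ltr01) => d.
  move=> [/andP[d0 d1] /andP[P0 Pd] lnP _ lndE] lrs eps.
  apply: has_cover_box => //.
  by have := key d d0 P0 lnP lndE lrs; rewrite th1 invr1 powRr1// ltW.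
have c20 : 0 < c / 2 by rewrite divr_gt0.
(* For theta < 1, d^(1 / theta - 1) tends to 0, whence 2 d^(1 / theta) / c <= d for small d. *)
have ith : 0 < theta^-1 - 1.
  by rewrite subr_gt0 invf_gt1// lt_neqAle th1.
exists 1, ((2 / c) `^ (s + eta)); split=> //; first by rewrite powR_gt0 ?divr_gt0.
have /cvgrPdist_le /(_ _ c20) dc := powR_cvg0 ith.
apply: filterS3 (near0_admissible ltr01) (near0_diam xy) dc => d.
move=> [/andP[d0 d1] /andP[P0 Pd] lnP _ lndE] dX.
rewrite sub0r normrN ger0_norm ?powR_ge0// => dc lrs eps; rewrite mul1r.
apply: has_cover_enlarge => //; rewrite ?powR_gt0 ?(ltW d1)//; last exact: key.
have -> : d `^ theta^-1 = d * d `^ (theta^-1 - 1).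
  by rewrite mulr_powRB1 ?invr_gt0// ltW.
by rewrite ler_pdivrMr//; nra.
Qed.

End comparison.

(** * Bounds on the log ratio and the four cases *)

Theorem proposition3p15 (R : realType) (X : metricType R)
    (X_perfect : uniformly_perfect X)
    (X_nontrivial : exists x y : X, x <> y)
    (Delta : R) (Phi : R -> R) (Phi_adm : admissible Delta Phi)
    (F : set X) (F_nonempty : F !=set0) (F_tb : totally_bounded F)
    (F_assouad : (assouad_dim F < +oo)%E) :
  exists theta1 theta2 : R,
  [/\ theta1%:E = limf_einf (EFin \o log_ratio Phi) 0^'+,
      theta2%:E = limf_esup (EFin \o log_ratio Phi) 0^'+ &
      0 <= theta1 <= theta2 /\ theta2 <= 1] /\
  [/\ (0 = theta2 /\ log_ratio Phi delta @[delta --> 0^'+] --> 0 ->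
        forall theta : R, 0 < theta <= 1 ->
          (lower_Phi_dim Delta Phi F <= lower_intermediate_dim theta F)%E /\
          (upper_Phi_dim Delta Phi F <= upper_intermediate_dim theta F)%E),
      (0 = theta1 /\ theta1 < theta2 ->
        [/\ (lower_intermediate_dim theta2 F <= upper_Phi_dim Delta Phi F)%E,
            (upper_Phi_dim Delta Phi F <= upper_intermediate_dim theta2 F)%E,
            (lower_intermediate_dim theta2 F = upper_intermediate_dim theta2 F ->
              upper_Phi_dim Delta Phi F = upper_intermediate_dim theta2 F) &
            forall theta : R, 0 < theta <= 1 ->
              (lower_Phi_dim Delta Phi F <=
                mine (upper_intermediate_dim theta F)
                     (lower_intermediate_dim theta2 F))%E]),
      (0 < theta1 /\ theta1 <= theta2 ->
        [/\ (lower_intermediate_dim theta1 F <= lower_Phi_dim Delta Phi F)%E,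
            (lower_Phi_dim Delta Phi F <=
              mine (upper_intermediate_dim theta1 F)
                   (lower_intermediate_dim theta2 F))%E,
            (maxe (upper_intermediate_dim theta1 F)
                  (lower_intermediate_dim theta2 F) <=
              upper_Phi_dim Delta Phi F)%E &
            (upper_Phi_dim Delta Phi F <= upper_intermediate_dim theta2 F)%E]) &
      (0 < theta1 /\ theta1 = theta2 ->
        lower_Phi_dim Delta Phi F = lower_intermediate_dim theta1 F /\
        upper_Phi_dim Delta Phi F = upper_intermediate_dim theta1 F)].
Proof.
have [Delta0 _ _ _] := Phi_adm; have [c c01 Xc] := X_perfect.
set theta1e := limf_einf _ _; set theta2e := limf_esup _ _.
have lr01 := near0_admissible Phi_adm ltr01.
have theta1e_ge0 : (0 <= theta1e)%E.
  apply: limf_einf_ge; apply: filterS lr01.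
  by move=> d [_ _ _ /andP[+ _] _]; rewrite lee_fin.
have theta2e_le1 : (theta2e <= 1)%E.
  apply: limf_esup_le; apply: filterS lr01.
  by move=> d [_ _ _ /andP[_ +] _]; rewrite lee_fin.
have theta12e : (theta1e <= theta2e)%E by exact: limf_einf_le_esup.
(* Both limits lie in [0, 1], hence are real numbers. *)
have theta1E : theta1e = (fine theta1e)%:E.
  rewrite fineK// ge0_fin_numE// (le_lt_trans theta12e)//.
  by rewrite (le_lt_trans theta2e_le1)// ltry.
have theta2E : theta2e = (fine theta2e)%:E.
  rewrite fineK// ge0_fin_numE ?(le_trans theta1e_ge0)//.
  by rewrite (le_lt_trans theta2e_le1)// ltry.
exists (fine theta1e), (fine theta2e).
move: (fine theta1e) (fine theta2e) theta1E theta2E.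
move=> theta1 theta2 theta1E theta2E.
have theta1_ge0 : 0 <= theta1 by rewrite -lee_fin -theta1E.
have theta2_le1 : theta2 <= 1 by rewrite -lee_fin -theta2E.
have theta12 : theta1 <= theta2 by rewrite -lee_fin -theta1E -theta2E.
(* The limsup bounds the log ratio above eventually and below frequently; the liminf bounds it below
   eventually and above frequently. The upper bounds are stated for every larger [theta > 0], to
   cover limits equal to 0. *)
have above2 theta s eta : theta2 <= theta -> 0 < theta -> 0 <= s -> 0 < eta ->
    \forall d \near (0 : R)^'+, log_ratio Phi d * s <= theta * (s + eta).
  move=> th theta0 s0 eta0; have [t tht Ht] := exponent_above theta0 s0 eta0.
  have : (theta2e < t%:E)%E by rewrite theta2E lte_fin (le_lt_trans th).
  by move=> /limf_esup_lt; apply: filterS => d /=; rewrite lte_fin => /Ht.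
have above1 theta s eta : theta1 <= theta -> 0 < theta -> 0 <= s -> 0 < eta ->
    frequently (0 : R)^'+ (fun d => log_ratio Phi d * s <= theta * (s + eta)).
  move=> th theta0 s0 eta0; have [t tht Ht] := exponent_above theta0 s0 eta0.
  have : (theta1e < t%:E)%E by rewrite theta1E lte_fin (le_lt_trans th).
  by move=> /limf_einf_lt; apply: frequently_sub => d /=; rewrite lte_fin => /Ht.
have below1 s eta : 0 < theta1 -> 0 <= s -> 0 < eta ->
    \forall d \near (0 : R)^'+, theta1 * s <= log_ratio Phi d * (s + eta).
  move=> theta0 s0 eta0; have [t tht Ht] := exponent_below theta0 s0 eta0.
  have : (t%:E < theta1e)%E by rewrite theta1E lte_fin.
  by move=> /limf_einf_gt; apply: filterS => d /=; rewrite lte_fin => /Ht.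
have below2 s eta : 0 < theta2 -> 0 <= s -> 0 < eta ->
    frequently (0 : R)^'+ (fun d => theta2 * s <= log_ratio Phi d * (s + eta)).
  move=> theta0 s0 eta0; have [t tht Ht] := exponent_below theta0 s0 eta0.
  have : (t%:E < theta2e)%E by rewrite theta2E lte_fin.
  by move=> /limf_esup_gt; apply: frequently_sub => d /=; rewrite lte_fin => /Ht.
have toPhi := theta_to_Phi Phi_adm c01 Xc X_nontrivial F.
have toth := Phi_to_theta Phi_adm c01 Xc X_nontrivial F.
have upper_le theta : 0 < theta <= 1 -> theta2 <= theta ->
    (upper_Phi_dim Delta Phi F <= upper_intermediate_dim theta F)%E.
  move=> th th2; rewrite upper_Phi_dimE// upper_intermediate_dimE//.
  apply: upper_le_upper (toPhi _ th) _ => s eta.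
  by apply: above2 => //; case/andP: th.
have lower_le theta : 0 < theta <= 1 -> theta2 <= theta ->
    (lower_Phi_dim Delta Phi F <= lower_intermediate_dim theta F)%E.
  move=> th th2; rewrite lower_Phi_dimE// lower_intermediate_dimE//.
  apply: lower_le_lower (toPhi _ th) _ => s eta.
  by apply: above2 => //; case/andP: th.
have lower_le_up theta : 0 < theta <= 1 -> theta1 <= theta ->
    (lower_Phi_dim Delta Phi F <= upper_intermediate_dim theta F)%E.
  move=> th th1; rewrite lower_Phi_dimE// upper_intermediate_dimE//.
  apply: lower_le_upper (toPhi _ th) _ => s eta.
  by apply: above1 => //; case/andP: th.
have le_upper : 0 < theta2 ->
    (lower_intermediate_dim theta2 F <= upper_Phi_dim Delta Phi F)%E.
  move=> th0; rewrite upper_Phi_dimE// lower_intermediate_dimE//.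
  have th : 0 < theta2 <= 1 by rewrite th0.
  by apply: lower_le_upper (toth _ th) _ => s eta; exact: below2.
have le_lower1 : 0 < theta1 ->
    (lower_intermediate_dim theta1 F <= lower_Phi_dim Delta Phi F)%E.
  move=> th0; rewrite lower_Phi_dimE// lower_intermediate_dimE//.
  have th : 0 < theta1 <= 1 by rewrite th0 (le_trans theta12).
  by apply: lower_le_lower (toth _ th) _ => s eta; exact: below1.
have le_upper1 : 0 < theta1 ->
    (upper_intermediate_dim theta1 F <= upper_Phi_dim Delta Phi F)%E.
  move=> th0; rewrite upper_Phi_dimE// upper_intermediate_dimE//.
  have th : 0 < theta1 <= 1 by rewrite th0 (le_trans theta12).
  by apply: upper_le_upper (toth _ th) _ => s eta; exact: below1.
split; first by rewrite theta1_ge0.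
split.
- move=> [theta20 _] theta th; have th2 : theta2 <= theta.
    by rewrite -theta20; case/andP: th => /ltW.
  by split; [exact: lower_le|exact: upper_le].
- move=> [theta10 theta1lt]; have th20 : 0 < theta2 by rewrite theta10.
  have th2 : 0 < theta2 <= 1 by rewrite th20.
  split=> [|||theta th]; [exact: le_upper|exact: upper_le| |].
    by move=> eq12; apply/eqP; rewrite eq_le upper_le//= -eq12 le_upper.
  rewrite le_min lower_le// andbT lower_le_up// -theta10.
  by case/andP: th => /ltW.
- move=> [th10 _]; have th20 : 0 < theta2 := lt_le_trans th10 theta12.
  have th2 : 0 < theta2 <= 1 by rewrite th20.
  have th1 : 0 < theta1 <= 1 by rewrite th10 (le_trans theta12).
  by rewrite le_min ge_max le_lower1// lower_le_up// lower_le// le_upper1//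
    le_upper// upper_le.
move=> [th10 th12]; have th1 : 0 < theta1 <= 1 by rewrite th10 (le_trans theta12).
split; apply/eqP; rewrite eq_le.
  by rewrite le_lower1// andbT lower_le// th12.
by rewrite le_upper1// andbT upper_le// th12.
Qed.
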